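(* Let $a,b\ge1$ be coprime integers with $a\le b$, write $P_{a/b}(u,v,w)=\sum_{i,j} A_{ij}\,u^iv^jw^{a+b-1-i-j}$, and let $\Delta_{a/b}=\operatorname{Conv}\{(i,j)\in\mathbb{Z}^2: A_{ij}\neq 0\}\subset\mathbb{R}^2$. Then $$\Delta_{a/b}=\Big\{(i,j)\in\mathbb{R}^2:\ i\ge 0,\ j\ge 0,\ \frac{i}{a}+\frac{j}{b}\ge 1,\ i+j\le a+b-1\Big\}.$$
   Context: Markov polynomials. Let $x,y,z$ be indeterminates. Consider the set consisting of all rationals $\rho\in[0,1]$, each written in lowest terms $\rho=a/b$ with integers $a\ge 0$, $b\ge 1$, together with the formal symbol $1/0$. Define Laurent polynomials $M_\rho(x,y,z)$ recursively by $M_{1/0}=y$, $M_{0/1}=x$, $M_{1/1}=\frac{x^2+y^2}{z}$, and: whenever $a/b$, $c/d$ are in this set with $|ad-bc|=1$ and $(a+2c)/(b+2d)\in[0,1]$, then $M_{\frac{a+2c}{b+2d}}=\big(M_{c/d}^2+M_{\frac{a+c}{b+d}}^2\big)/M_{a/b}$. This determines $M_\rho$ for every rational $\rho\in[0,1]$. Numerator. For coprime $1\le a\le b$, $P_{a/b}(u,v,w)$ denotes the homogeneous polynomial of degree $a+b-1$ (with non-negative integer coefficients) such that $M_{a/b}(x,y,z)=P_{a/b}(x^2,y^2,z^2)/(x^{a-1}y^{b-1}z^{a+b-1})$; its existence is known. *)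

(* Defs.v *)
From HB Require Import structures.
From mathcomp Require Import all_boot all_order all_algebra.
From mathcomp Require Import mpoly.
From mathcomp Require Import reals.
Set Implicit Arguments. Unset Strict Implicit. Unset Printing Implicit Defensive.
Import Order.TTheory GRing.Theory Num.Theory.
Local Open Scope ring_scope.

Definition Pol := {mpoly int[3]}.
(* The field of rational functions Q(x,y,z) (as fraction field of Z[x,y,z]);
   Laurent polynomials live inside it. *)
Definition Frac := {fraction Pol}.

Definition toF (p : Pol) : Frac := @FracField.tofrac _ p.

Definition iX : 'I_3 := @Ordinal 3 0 isT.
Definition iY : 'I_3 := @Ordinal 3 1 isT.
Definition iZ : 'I_3 := @Ordinal 3 2 isT.

Definition xF : Frac := toF 'X_iX.
Definition yF : Frac := toF 'X_iY.
Definition zF : Frac := toF 'X_iZ.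

(* Markov polynomials, as the graph of the recursive definition:
   MarkovM a b m  means  M_{a/b} = m.  The rational a/b is encoded by the pair
   (a, b) of naturals (with (1,0) the formal symbol 1/0).  Each clause is
   exactly one clause of the paper's recursive definition; the side conditions
   |ad - bc| = 1 and (a+2c)/(b+2d) in [0,1] are as in the paper (all fractions
   occurring are automatically in lowest terms, since |ad-bc| = 1). *)
Inductive MarkovM : nat -> nat -> Frac -> Prop :=
| MarkovM_10 : MarkovM 1 0 yF
| MarkovM_01 : MarkovM 0 1 xF
| MarkovM_11 : MarkovM 1 1 ((xF ^+ 2 + yF ^+ 2) / zF)
| MarkovM_step (a b c d : nat) (m1 m2 m3 : Frac) :
    ((a * d == b * c + 1)%N || (b * c == a * d + 1)%N) ->
    (a + 2 * c <= b + 2 * d)%N ->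
    MarkovM a b m1 -> MarkovM c d m2 -> MarkovM (a + c) (b + d) m3 ->
    MarkovM (a + 2 * c) (b + 2 * d) ((m2 ^+ 2 + m3 ^+ 2) / m1).

Definition subst_squares (P : Pol) : Pol :=
  P \mPo [tuple ('X_iX : Pol) ^+ 2; ('X_iY : Pol) ^+ 2; ('X_iZ : Pol) ^+ 2].

Definition supp_ij (P : Pol) : seq (nat * nat) :=
  [seq ((m : 'X_{1..3}) iX, (m : 'X_{1..3}) iY) | m <- msupp P].

Definition in_conv (R : realType) (s : seq (nat * nat)) (p : R * R) : Prop :=
  exists w : 'I_(size s) -> R,
    [/\ forall k, 0 <= w k,
        \sum_k w k = 1,
        p.1 = \sum_k w k * ((nth (0, 0)%N s k).1)%:R &
        p.2 = \sum_k w k * ((nth (0, 0)%N s k).2)%:R].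

(* Main.v *)
Require Import Defs.
From HB Require Import structures.
From mathcomp Require Import all_boot all_order all_algebra.
From mathcomp Require Import mpoly zify ring.
From mathcomp Require Import reals.
Import Order.TTheory GRing.Theory Num.Theory.
Local Open Scope ring_scope.

(** For an integral weight l on x, y, z, let deg_l be the degree in T after
    the substitution X_i -> X_i T^(l i), extended to rational functions.  Leading
    terms of a sum of two squares cannot cancel over Z, so
    deg_l (f^2 + g^2) = 2 max (deg_l f, deg_l g), and the Markov recursion becomes
    a recursion on degrees which has explicit solutions.  The degrees of M_{a/b}
    are twice the support function of P_{a/b} up to a shift: finitely many weights
    give the defining inequalities and show that the four vertices (a, 0), (0, b),
    (a + b - 1, 0), (0, a + b - 1) lie in the support. *)

(** * Sums of two squares over the integers *)

Lemma mpoly_sqr_add_eq0 (n : nat) (p q : {mpoly int[n]}) :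
  p ^+ 2 + q ^+ 2 = 0 -> p = 0.
Proof.
move=> h; apply/eqP; rewrite -mleadc_eq0.
have e : p ^+ 2 = - q ^+ 2 by apply/eqP; rewrite -addr_eq0 h.
have lead_sqr (r : {mpoly int[n]}) : (r ^+ 2)@_(mlead (r ^+ 2)) = r@_(mlead r) ^+ 2.
  have [->|r0] := eqVneq r 0; first by rewrite expr0n /= mleadc0 expr0n.
  by rewrite mleadcX_proper //; apply/lregP; rewrite mleadc_eq0.
(* The squares of the two leading coefficients are opposite integers, and both are nonnegative, so
   they vanish. *)
have := lead_sqr p; rewrite e mleadN mcoeffN lead_sqr.
have := sqr_ge0 (q@_(mlead q)); have := sqr_ge0 (p@_(mlead p)).
by rewrite -sqrf_eq0; lia.
Qed.

(** Cancellation at the top is conceivable only for equal degrees, and there the top coefficient is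
    a sum of two nonzero squares in [Pol], excluded from vanishing by [mpoly_sqr_add_eq0]. *)
Lemma size_sqr_add (P Q : {poly Pol}) : P != 0 -> Q != 0 ->
  size (P ^+ 2 + Q ^+ 2) = (maxn (size P) (size Q)).*2.-1.
Proof.
wlog: P Q / (size Q <= size P)%N => [H | le_QP P0 Q0].
  case/orP: (leq_total (size Q) (size P)) => h P0 Q0; first exact: H.
  by rewrite addrC maxnC; apply: H.
have szS (S : {poly Pol}) : S != 0 -> size (S ^+ 2) = (size S).*2.-1.
  by move=> S0; rewrite expr2 size_mul // addnn.
have sP : (0 < size P)%N by rewrite lt0n size_poly_eq0.
rewrite (maxn_idPl le_QP); move: (le_QP); rewrite leq_eqVlt => /orP[/eqP eqs|lt].
  apply/eqP; rewrite eqn_leq; apply/andP; split.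
    by apply: leq_trans (size_polyD _ _) _; rewrite !szS // eqs maxnn.
  (* As [size] is the degree plus one, the index [(size P + size P).-2] is twice the degree of
     [P]. *)
  have sE : ((size P).*2.-1 = (size P + size P).-2.+1)%N by move: sP; clear; lia.
  rewrite sE ltnNge; apply: contraNN P0 => /leq_sizeP/(_ _ (leqnn _)).
  have lcE (S : {poly Pol}) : size S = size P ->
      (S ^+ 2)`_(size P + size P).-2 = lead_coef S ^+ 2.
    move=> sS; case: (eqVneq S 0) => [S0|S0].
      by move: sP; rewrite -sS S0 size_poly0.
    have <- := lead_coef_exp S 2; rewrite lead_coefE szS // sS.
    by congr (_`_ _); clear; lia.
  rewrite coefD !lcE // => /mpoly_sqr_add_eq0 /eqP.
  by rewrite lead_coef_eq0.
by rewrite size_polyDl szS // szS //; move: lt; clear; lia.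
Qed.

(** * Weighted degrees of polynomials and rational functions *)

HB.lock Definition weighted (l : 'I_3 -> nat) (p : Pol) : {poly Pol} :=
  mmap ((@polyC Pol) \o (@mpolyC 3 int)) (fun i => ('X_i : Pol)%:P * 'X^(l i)) p.

Lemma weightedM l : {morph weighted l : p q / p * q}.
Proof. by move=> p q; rewrite weighted.unlock rmorphM. Qed.

Lemma weightedD l : {morph weighted l : p q / p + q}.
Proof. by move=> p q; rewrite weighted.unlock rmorphD. Qed.

Lemma weighted0 l : weighted l 0 = 0.
Proof. by rewrite weighted.unlock rmorph0. Qed.

Lemma weighted_sqr l p : weighted l (p ^+ 2) = weighted l p ^+ 2.
Proof. by rewrite !expr2 weightedM. Qed.

Definition wmdeg (l : 'I_3 -> nat) (m : 'X_{1..3}) : nat := (\sum_i l i * m i)%N.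

Lemma weightedX l (m : 'X_{1..3}) : weighted l 'X_[m] = ('X_[m] : Pol)%:P * 'X^(wmdeg l m).
Proof.
rewrite weighted.unlock mmapX /mmap1.
rewrite [in RHS]mpolyXE_id /wmdeg rmorph_prod /= -prodrXr -big_split /=.
by apply: eq_bigr => i _; rewrite exprMn rmorphXn /= exprM.
Qed.

Lemma weightedZ l c p : weighted l (c *: p) = (c%:MP : Pol)%:P * weighted l p.
Proof. by rewrite weighted.unlock mmapZ. Qed.

(* [size] is the degree plus one; the shifts cancel in the difference. *)
Definition has_wdeg (l : 'I_3 -> nat) (f : Frac) (d : int) :=
  exists p q : Pol, [/\ weighted l p != 0, weighted l q != 0, f = toF p / toF q &
    d = (size (weighted l p))%:Z - (size (weighted l q))%:Z].

Lemma toF_neq0 l p : weighted l p != 0 -> toF p != 0.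
Proof.
by move=> p0; rewrite /toF tofrac_eq0; apply: contraNneq p0 => ->; rewrite weighted0.
Qed.

Lemma toFM p q : toF (p * q) = toF p * toF q. Proof. exact: tofracM. Qed.
Lemma toFD p q : toF (p + q) = toF p + toF q. Proof. exact: tofracD. Qed.
Lemma toFX p n : toF (p ^+ n) = toF p ^+ n. Proof. exact: tofracXn. Qed.

Lemma size_weightedX l m : size (weighted l 'X_[m]) = (wmdeg l m).+1.
Proof.
by rewrite weightedX size_Cmul ?size_polyXn // -mleadc_eq0 mleadXm mcoeffX eqxx oner_eq0.
Qed.

Lemma weightedX_neq0 l m : weighted l 'X_[m] != 0.
Proof. by rewrite -size_poly_eq0 size_weightedX. Qed.

Lemma wmdegU l i : wmdeg l U_(i) = l i.
Proof.
rewrite /wmdeg (bigD1 i) //= mnm1E eqxx muln1 big1 ?addn0 // => j ne.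
by rewrite mnm1E eq_sym (negbTE ne) muln0.
Qed.

Lemma wmdeg0 l : wmdeg l 0%MM = 0%N.
Proof. by rewrite /wmdeg big1 // => i _; rewrite mnmE muln0. Qed.

Lemma has_wdeg_X l i : has_wdeg l (toF 'X_i) (l i)%:Z.
Proof.
exists 'X_i, 'X_[0]; split; try exact: weightedX_neq0.
  by rewrite mpolyX0 /toF tofrac1 divr1.
by rewrite !size_weightedX wmdegU wmdeg0 -addn1 PoszD addrK.
Qed.

(** This common denominator keeps a sum of two squares as a factor of the numerator, as
    [size_sqr_add] requires. *)
Lemma frac_markov_step (F : fieldType) (p1 q1 p2 q2 p3 q3 : F) :
  p1 != 0 -> q1 != 0 -> q2 != 0 -> q3 != 0 ->
  ((p2 / q2) ^+ 2 + (p3 / q3) ^+ 2) / (p1 / q1) =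
  ((p2 * q3) ^+ 2 + (p3 * q2) ^+ 2) * q1 / ((q2 * q3) ^+ 2 * p1).
Proof. by move=> p10 q10 q20 q30; field; rewrite p10 q10 q20 q30. Qed.

Lemma has_wdeg_step l m1 m2 m3 d1 d2 d3 :
  has_wdeg l m1 d1 -> has_wdeg l m2 d2 -> has_wdeg l m3 d3 ->
  has_wdeg l ((m2 ^+ 2 + m3 ^+ 2) / m1) (2 * Num.max d2 d3 - d1).
Proof.
move=> [p1 [q1 [p10 q10 -> ->]]] [p2 [q2 [p20 q20 -> ->]]] [p3 [q3 [p30 q30 -> ->]]].
have sz_pos (p : Pol) : weighted l p != 0 -> (0 < size (weighted l p))%N.
  by rewrite lt0n size_poly_eq0.
have := (sz_pos _ p10, sz_pos _ q10, sz_pos _ p20, sz_pos _ q20,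
  sz_pos _ p30, sz_pos _ q30) => -[[[[[sp1 sq1] sp2] sq2] sp3] sq3].
pose Q2 := weighted l p2 * weighted l q3; pose Q3 := weighted l p3 * weighted l q2.
have Q20 : Q2 != 0 by rewrite mulf_neq0.
have Q30 : Q3 != 0 by rewrite mulf_neq0.
have szQ : size (Q2 ^+ 2 + Q3 ^+ 2) =
    (maxn (size (weighted l p2) + size (weighted l q3)).-1
          (size (weighted l p3) + size (weighted l q2)).-1).*2.-1.
  by rewrite size_sqr_add // /Q2 /Q3 !size_mul.
have N0 : Q2 ^+ 2 + Q3 ^+ 2 != 0.
  rewrite -size_poly_eq0 szQ; move: sp2 sq2 sp3 sq3.
  by clear; do !move: (size _) => ?; lia.
have D0 : weighted l q2 * weighted l q3 != 0 by rewrite mulf_neq0.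
exists (((p2 * q3) ^+ 2 + (p3 * q2) ^+ 2) * q1), ((q2 * q3) ^+ 2 * p1); split.
- by rewrite weightedM weightedD !weighted_sqr !weightedM -/Q2 -/Q3 mulf_neq0.
- by rewrite weightedM weighted_sqr weightedM mulf_neq0 // expf_neq0.
- by rewrite !(toFM, toFX, toFD) frac_markov_step // (toF_neq0 l).
- rewrite !(weightedM, weightedD, weighted_sqr) -/Q2 -/Q3.
  have szD : size ((weighted l q2 * weighted l q3) ^+ 2) =
      ((size (weighted l q2) + size (weighted l q3)).-1).*2.-1.
    by rewrite expr2 size_mul // (size_mul q20 q30) addnn.
  rewrite (size_mul N0) // szQ (size_mul (expf_neq0 2 D0)) // szD.
  move: sp1 sq1 sp2 sq2 sp3 sq3; clear.
  by do !move: (size _) => ?; lia.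
Qed.

(** Reduces the degree of a Markov polynomial to guessing a closed form [dg]: it only has to match
    the three initial values and solve the recursion with maximum in place of sum of squares. *)
Lemma MarkovM_has_wdeg l (dg : nat -> nat -> int) a b m :
  dg 1%N 0%N = (l iY)%:Z -> dg 0%N 1%N = (l iX)%:Z ->
  dg 1%N 1%N = 2 * Num.max (l iX)%:Z (l iY)%:Z - (l iZ)%:Z ->
  (forall a b c d, dg (a + 2 * c)%N (b + 2 * d)%N =
     2 * Num.max (dg c d) (dg (a + c)%N (b + d)%N) - dg a b) ->
  MarkovM a b m -> has_wdeg l m (dg a b).
Proof.
move=> d10 d01 d11 dS; elim=> [|||{}a {}b c d m1 m2 m3 _ _ _ h1 _ h2 _ h3].
- by rewrite d10; apply: has_wdeg_X.
- by rewrite d01; apply: has_wdeg_X.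
- by rewrite d11; apply: has_wdeg_step; apply: has_wdeg_X.
- by rewrite dS; apply: has_wdeg_step.
Qed.

(** * From degrees to the exponents of the numerator *)

Lemma wmdegE l m : wmdeg l m = (l iX * m iX + l iY * m iY + l iZ * m iZ)%N.
Proof.
rewrite /wmdeg !big_ord_recl big_ord0 addn0 addnA.
by congr (l _ * m _ + l _ * m _ + l _ * m _)%N; apply: val_inj.
Qed.

Lemma subst_squaresE P :
  subst_squares P = \sum_(m <- msupp P) P@_m *: 'X_[m *+ 2].
Proof.
rewrite /subst_squares comp_mpolyEX; apply: eq_bigr => m _; congr (_ *: _).
rewrite comp_mpolyX [in RHS]mpolyXE_id; apply: eq_bigr => i _.
rewrite mulmnE mulnC exprM; congr (_ ^+ _).
by case: i => [[|[|[|]]]] //= lti; rewrite (tnth_nth 0) /=; congr (_ ^+ 2);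
  congr ('X_ _); apply: val_inj.
Qed.

Lemma coef_weighted_squares l P k :
  (weighted l (subst_squares P))`_k =
  \sum_(m <- msupp P | k == (2 * wmdeg l m)%N) P@_m *: 'X_[m *+ 2].
Proof.
have wS (r : seq 'X_{1..3}) (F : 'X_{1..3} -> Pol) :
    weighted l (\sum_(m <- r) F m) = \sum_(m <- r) weighted l (F m).
  by apply: (big_morph _ (weightedD l) (weighted0 l)).
rewrite subst_squaresE wS coef_sum [RHS]big_mkcond; apply: eq_bigr => m _.
rewrite weightedZ weightedX mulrA -polyCM coefCM coefXn mul_mpolyC.
have -> : wmdeg l (m *+ 2) = (2 * wmdeg l m)%N.
  by rewrite !wmdegE !mulmnE; ring.
by case: eqP => _; rewrite ?mulr1 ?mulr0.
Qed.

(** The coefficients of [weighted] retain the variables and doubling exponents is injective, so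
    terms of equal weight cannot cancel: the monomial ['X_[m *+ 2]] survives in the coefficient of
    degree [2 * wmdeg l m]. *)
Lemma msupp_lt_size l P m : m \in msupp P ->
  (2 * wmdeg l m < size (weighted l (subst_squares P)))%N.
Proof.
move=> mP; rewrite ltnNge; apply/negP => /leq_sizeP/(_ _ (leqnn _)).
rewrite coef_weighted_squares => /(congr1 (mcoeff (m *+ 2)%MM)).
rewrite mcoeff0 big_mkcond raddf_sum /= (bigD1_seq m) ?msupp_uniq //= eqxx.
rewrite mcoeffZ mcoeffX eqxx mulr1 big1 => [|m' ne].
  by rewrite addr0 => /eqP; rewrite mcoeff_eq0 mP.
case: ifP => _; last exact: mcoeff0.
rewrite mcoeffZ mcoeffX; case: eqP => [e|_]; last by rewrite mulr0.
case/eqP: ne; apply/mnmP => i; move/mnmP/(_ i): e; rewrite !mulmnE.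
by lia.
Qed.

Lemma msupp_size_witness l P : weighted l (subst_squares P) != 0 ->
  exists2 m, m \in msupp P &
    (2 * wmdeg l m).+1 = size (weighted l (subst_squares P)).
Proof.
move=> W0; have := W0; rewrite -lead_coef_eq0 lead_coefE coef_weighted_squares.
case: (altP (@hasP _ (fun m => (size (weighted l (subst_squares P))).-1 ==
   (2 * wmdeg l m)%N) (msupp P))) => [[m mP /eqP eqm] _|/hasPn H].
  by exists m => //; rewrite -eqm prednK // lt0n size_poly_eq0.
by rewrite big_seq_cond big1 ?eqxx // => m /andP[/H/negbTE ->].
Qed.

(** Clearing denominators gives an identity of polynomials, on which degrees are additive. Hence
    twice the support function of [P] at [l] is the degree of [m] plus that of the monomial
    denominator. *)
Lemma msupp_max_wdeg l m d mon P :
  has_wdeg l m d -> m * toF 'X_[mon] = toF (subst_squares P) ->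
  (forall n, n \in msupp P -> (2 * wmdeg l n)%:Z <= d + (wmdeg l mon)%:Z) /\
  (exists2 n, n \in msupp P & (2 * wmdeg l n)%:Z = d + (wmdeg l mon)%:Z).
Proof.
move=> [p [q [p0 q0 -> ->]]] e.
have {}e : p * 'X_[mon] = subst_squares P * q.
  apply/eqP; rewrite -tofrac_eq -!/(toF _) !toFM -e; apply/eqP.
  by rewrite mulrAC divfK // (toF_neq0 l).
have := congr1 (weighted l) e; rewrite !weightedM => {}e.
have S0 : weighted l (subst_squares P) != 0.
  apply: contraTneq (mulf_neq0 p0 (weightedX_neq0 l mon)) => S0.
  by rewrite e S0 mul0r eqxx.
have := congr1 (fun r : {poly Pol} => size r) e.
rewrite (size_mul p0 (weightedX_neq0 l mon)) (size_mul S0 q0) size_weightedX.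
have [n nP nS] := msupp_size_witness l P S0.
have lt n' := msupp_lt_size l P n'.
have sp : (0 < size (weighted l p))%N by rewrite lt0n size_poly_eq0.
have sq : (0 < size (weighted l q))%N by rewrite lt0n size_poly_eq0.
move: sp sq nS lt; clear -nP.
do !move: (size _) => ?; move=> sp sq nS lt eqs; split; last by exists n => //; lia.
by move=> n' /lt; lia.
Qed.

(** * Inequalities and vertices of the support *)

Section Support.

Variables (a b : nat) (m : Frac) (P : Pol).
Hypotheses (a_gt0 : (1 <= a)%N) (b_gt0 : (1 <= b)%N).
Hypothesis Mab : MarkovM a b m.
Hypothesis homP : P \is @ishomog1 3 int (a + b - 1)%N mdeg.
Hypothesis numP :
  m * toF ((('X_iX : Pol) ^+ (a - 1) * ('X_iY : Pol) ^+ (b - 1)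
        * ('X_iZ : Pol) ^+ (a + b - 1))) = toF (subst_squares P).

Let mon : 'X_{1..3} := (U_(iX) *+ (a - 1) + U_(iY) *+ (b - 1) + U_(iZ) *+ (a + b - 1))%MM.

Let num_mon : m * toF 'X_[mon] = toF (subst_squares P).
Proof. by rewrite /mon !mpolyXD -!mpolyXn. Qed.

Let wmdeg_mon l :
  wmdeg l mon = (l iX * (a - 1) + l iY * (b - 1) + l iZ * (a + b - 1))%N.
Proof. by rewrite wmdegE !mnmDE !mulmnE !mnm1E /= !mul1n !mul0n !addn0. Qed.

Lemma msupp_mdeg n : n \in msupp P -> (n iX + n iY + n iZ = a + b - 1)%N.
Proof.
move=> nP; have /(_ n nP) /eqP <- := allP homP.
rewrite -[RHS]/(mdeg n) mdegE !big_ord_recl big_ord0 addn0 addnA.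
by congr (n _ + n _ + n _)%N; apply: val_inj.
Qed.

(* For the weights (q, p, p + q) the degree of M_{c/d} is |pc - qd|, since
   |s + t| + |s - t| = 2 max(|s|, |t|). *)
Lemma msupp_min (p q : nat) :
  (forall n, n \in msupp P -> (minn (p * a) (q * b) <= p * n iX + q * n iY)%N) /\
  (exists2 n, n \in msupp P & (minn (p * a) (q * b) = p * n iX + q * n iY)%N).
Proof.
pose l (i : 'I_3) := nth 0%N [:: q; p; (p + q)%N] i.
pose dg (c d : nat) : int := `|(p * c)%:Z - (q * d)%:Z|.
have dl : has_wdeg l m (dg a b).
  apply: MarkovM_has_wdeg Mab; rewrite /dg /l /=; [lia|lia|lia|].
  by move=> a' b' c d; lia.
have [le [n nP eqn]] := msupp_max_wdeg _ _ _ _ _ dl num_mon.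
(* By homogeneity the weight [(q, p, p + q)] of an exponent is [(p + q) * (a + b - 1)] minus
   [p * n' iX + q * n' iY], so the maximum becomes a minimum. Its value comes from
   [|s - t| = s + t - 2 min(s, t)] with [s = p * a], [t = q * b]. *)
have key n' : n' \in msupp P ->
    ((2 * wmdeg l n')%:Z + 2 * (p * n' iX + q * n' iY)%:Z =
     dg a b + (wmdeg l mon)%:Z + 2 * (minn (p * a) (q * b))%:Z).
  move=> /msupp_mdeg e; have := congr1 (muln (p + q)) e.
  rewrite wmdeg_mon wmdegE /dg /l /=; move: a_gt0 b_gt0; clear.
  case: a => // a' _; case: b => // b' _.
  have -> : (a'.+1 + b'.+1 - 1 = a' + b' + 1)%N by lia.
  rewrite !subn1 /=; lia.
split=> [n' n'P|]; first by have := key _ n'P; have := le _ n'P; lia.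
by exists n => //; have := key _ nP; lia.
Qed.

(** For the weights (1, 0, 0) the term of index [(a + c, b + d)] always attains the maximum in the
    recursion, so the degree is affine in the index. *)
Lemma msupp_max_iX : exists2 n, n \in msupp P & n iX = (a + b - 1)%N.
Proof.
pose l (i : 'I_3) := nth 0%N [:: 1; 0; 0]%N i.
pose dg (c d : nat) : int := c%:Z + 2 * d%:Z - 1.
have dl : has_wdeg l m (dg a b).
  by apply: MarkovM_has_wdeg Mab; rewrite /dg /l //= => *; lia.
have [_ [n nP eqn]] := msupp_max_wdeg _ _ _ _ _ dl num_mon.
exists n => //; move: eqn; rewrite wmdeg_mon wmdegE /dg /l /=.
by move: a_gt0 b_gt0; clear; lia.
Qed.

Lemma msupp_max_iY : exists2 n, n \in msupp P & n iY = (a + b - 1)%N.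
Proof.
pose l (i : 'I_3) := nth 0%N [:: 0; 1; 0]%N i.
pose dg (c d : nat) : int := 2 * c%:Z + d%:Z - 1.
have dl : has_wdeg l m (dg a b).
  by apply: MarkovM_has_wdeg Mab; rewrite /dg /l //= => *; lia.
have [_ [n nP eqn]] := msupp_max_wdeg _ _ _ _ _ dl num_mon.
exists n => //; move: eqn; rewrite wmdeg_mon wmdegE /dg /l /=.
by move: a_gt0 b_gt0; clear; lia.
Qed.

Lemma mem_supp_ij n : n \in msupp P -> (n iX, n iY) \in supp_ij P.
Proof. exact: map_f. Qed.

(** The choice [p = b], [q = a] makes both arguments of the minimum equal to [a * b]: it is the
    normal to the edge from (a, 0) to (0, b). *)
Lemma supp_ij_bounds i j : (i, j) \in supp_ij P ->
  (a * b <= b * i + a * j)%N /\ (i + j <= a + b - 1)%N.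
Proof.
case/mapP => n nP [-> ->]; have [le _] := msupp_min b a; split.
  by have := le _ nP; rewrite [(b * a)%N]mulnC minnn.
by rewrite -(msupp_mdeg _ nP) leq_addr.
Qed.

(** The weights (1, a + 1) single out a vertex: the minimum is [a], and a second exponent of at
    least 1 would already cost [a + 1]. *)
Lemma supp_ij_a0 : (a, 0%N) \in supp_ij P.
Proof.
have [_ [n nP e]] := msupp_min 1 a.+1.
have {}e : (a = n iX + a.+1 * n iY)%N by move: e b_gt0; nia.
have nY : n iY = 0%N by nia.
have nX : n iX = a by lia.
by have := mem_supp_ij _ nP; rewrite nX nY.
Qed.

Lemma supp_ij_0b : (0%N, b) \in supp_ij P.
Proof.
have [_ [n nP e]] := msupp_min b.+1 1.
have {}e : (b = b.+1 * n iX + n iY)%N by move: e a_gt0; nia.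
have nX : n iX = 0%N by nia.
have nY : n iY = b by lia.
by have := mem_supp_ij _ nP; rewrite nX nY.
Qed.

Lemma supp_ij_n0 : ((a + b - 1)%N, 0%N) \in supp_ij P.
Proof.
have [n nP nX] := msupp_max_iX; have nN := msupp_mdeg _ nP.
have nY : n iY = 0%N by lia.
by have := mem_supp_ij _ nP; rewrite nX nY.
Qed.

Lemma supp_ij_0n : (0%N, (a + b - 1)%N) \in supp_ij P.
Proof.
have [n nP nY] := msupp_max_iY; have nN := msupp_mdeg _ nP.
have nX : n iX = 0%N by lia.
by have := mem_supp_ij _ nP; rewrite nX nY.
Qed.

End Support.

(** * Convex hulls in the plane *)

Section Hull.

Variables (R : realType) (s : seq (nat * nat)).

Lemma in_conv_mem (v : nat * nat) :
  v \in s -> in_conv s ((v.1%:R, v.2%:R) : R * R).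
Proof.
move=> vs; have lt : (index v s < size s)%N by rewrite index_mem.
exists (fun k => (k == Ordinal lt)%:R); split=> [k||/=|/=]; first exact: ler0n.
- by rewrite (bigD1 (Ordinal lt)) //= eqxx big1 ?addr0 // => k /negbTE ->.
- rewrite (bigD1 (Ordinal lt)) //= eqxx mul1r nth_index // big1 ?addr0 //.
  by move=> k /negbTE ->; rewrite mul0r.
- rewrite (bigD1 (Ordinal lt)) //= eqxx mul1r nth_index // big1 ?addr0 //.
  by move=> k /negbTE ->; rewrite mul0r.
Qed.

Lemma in_conv_convex (t : R) (p q : R * R) : 0 <= t <= 1 -> in_conv s p -> in_conv s q ->
  in_conv s (t * p.1 + (1 - t) * q.1, t * p.2 + (1 - t) * q.2).
Proof.
move=> /andP[t0 t1] [w [w0 w1 -> ->]] [z [z0 z1 -> ->]].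
exists (fun k => t * w k + (1 - t) * z k); split=> [k||/=|/=].
- by rewrite addr_ge0 // mulr_ge0 // subr_ge0.
- by rewrite big_split -!mulr_sumr w1 z1 /=; ring.
- by rewrite !mulr_sumr -big_split; apply: eq_bigr => k _ /=; ring.
- by rewrite !mulr_sumr -big_split; apply: eq_bigr => k _ /=; ring.
Qed.

Lemma in_conv_halfplane (c1 c2 c : R) (p : R * R) :
  (forall v : nat * nat, v \in s -> c <= c1 * v.1%:R + c2 * v.2%:R) ->
  in_conv s p -> c <= c1 * p.1 + c2 * p.2.
Proof.
move=> H [w [w0 w1 -> ->]]; have -> : c = \sum_k w k * c by rewrite -mulr_suml w1 mul1r.
rewrite !mulr_sumr -big_split /=.
apply: ler_sum => k _; have := H _ (mem_nth (0, 0)%N (ltn_ord k)).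
move/(ler_wpM2l (w0 k)).
by rewrite mulrDr !mulrA ![_ * w k]mulrC.
Qed.

(* The ray through (x, y) leaves the region at (x, y) / t and (x, y) * n / u,
   which lie on the edges [(a, 0), (0, b)] and [(n, 0), (0, n)]. *)
Lemma in_conv_trapezoid (a b n : nat) (x y : R) :
  (0 < a)%N -> (0 < b)%N ->
  (a, 0)%N \in s -> (0, b)%N \in s -> (n, 0)%N \in s -> (0, n)%N \in s ->
  0 <= x -> 0 <= y -> 1 <= x / a%:R + y / b%:R -> x + y <= n%:R ->
  in_conv s (x, y).
Proof.
move=> a0 b0 sa sb sn sm x0 y0; set t := _ + _; set u := x + y => t1 un.
have aR : 0 < a%:R :> R by rewrite ltr0n.
have bR : 0 < b%:R :> R by rewrite ltr0n.
have t0 : 0 < t by apply: lt_le_trans t1.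
(* The inequality [1 <= t] excludes the origin. *)
have u0 : 0 < u.
  rewrite lt_neqAle addr_ge0 // andbT eq_sym; apply: contraTneq t1 => /eqP.
  rewrite paddr_eq0 // => /andP[/eqP xe /eqP ye].
  by rewrite /t xe ye !mul0r addr0 -ltNge ltr01.
have inner : in_conv s (x / t, y / t).
  (* The barycentric coordinate of the inner point with respect to (a, 0); the one with respect to
     (0, b) is [y / b / t]. *)
  have tx : 0 <= x / a%:R / t <= 1.
    rewrite !divr_ge0 ?(ltW aR) ?(ltW t0) //= ler_pdivrMr // mul1r /t lerDl.
    by rewrite divr_ge0 // ltW.
  have ty : 1 - x / a%:R / t = y / b%:R / t.
    by rewrite (_ : y / b%:R = t - x / a%:R) ?mulrBl ?divff ?gt_eqF // /t addrC addKr.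
  have := in_conv_convex _ _ _ tx (in_conv_mem _ sa) (in_conv_mem _ sb).
  congr (in_conv s (_, _)); rewrite ty /= mulr0 ?addr0 ?add0r.
    by rewrite mulrAC divfK ?gt_eqF.
  by rewrite mulrAC divfK ?gt_eqF.
have outer : in_conv s (x * (n%:R / u), y * (n%:R / u)).
  have tx : 0 <= x / u <= 1.
    by rewrite divr_ge0 ?(ltW u0) //= ler_pdivrMr // mul1r /u lerDl.
  have ty : 1 - x / u = y / u.
    by rewrite (_ : y = u - x) ?mulrBl ?divff ?gt_eqF // /u addrC addKr.
  have := in_conv_convex _ _ _ tx (in_conv_mem _ sn) (in_conv_mem _ sm).
  by congr (in_conv s (_, _)); rewrite ty /= mulr0 ?addr0 ?add0r mulrA mulrAC.
move: inner outer; have : 1 <= n%:R / u by rewrite ler_pdivlMr // mul1r.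
have : t^-1 <= 1 by rewrite invf_le1.
move: (n%:R / u) t^-1 => nu mu mu1 nu1 inner outer.
(* The point sits at parameter 1 on its ray, between the inner point at [mu] and the outer one at
   [nu]. If these coincide, both parameters are 1. *)
have [eq_mu|lt_mu] := eqVneq mu nu.
  have e : mu = 1 by apply/eqP; rewrite eq_le mu1 eq_mu nu1.
  by rewrite e !mulr1 in inner.
have d0 : 0 < nu - mu.
  by rewrite subr_gt0 lt_neqAle lt_mu (le_trans mu1).
(* The solution [r] of [r * nu + (1 - r) * mu = 1]. *)
have tl : 0 <= (1 - mu) / (nu - mu) <= 1.
  rewrite divr_ge0 ?subr_ge0 ?(le_trans mu1) //= ler_pdivrMr // mul1r.
  by rewrite lerD2r.
have := in_conv_convex _ _ _ tl outer inner.
by congr (in_conv s (_, _)) => /=; field; rewrite gt_eqF.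
Qed.

End Hull.

Theorem theorem3p2 (R : realType) (a b : nat) (m : Frac) (P : Pol) :
  (1 <= a)%N -> (a <= b)%N -> coprime a b ->
  MarkovM a b m ->
  P \is @ishomog1 3 int (a + b - 1)%N mdeg ->
  m * toF ((('X_iX : Pol) ^+ (a - 1) * ('X_iY : Pol) ^+ (b - 1)
        * ('X_iZ : Pol) ^+ (a + b - 1))) = toF (subst_squares P) ->
  forall p : R * R,
    in_conv (supp_ij P) p <->
    [/\ 0 <= p.1, 0 <= p.2,
        p.1 / a%:R + p.2 / b%:R >= 1 &
        p.1 + p.2 <= (a + b)%:R - 1].
Proof.
move=> a0 leab _ Mab homP numP [x y] /=.
have b0 := leq_trans a0 leab.
have bounds := supp_ij_bounds _ _ _ _ a0 b0 Mab homP numP.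
have nE : (a + b)%:R - 1 = (a + b - 1)%:R :> R.
  by rewrite natrB // addn_gt0 a0.
have aR : 0 < a%:R :> R by rewrite ltr0n.
have bR : 0 < b%:R :> R by rewrite ltr0n.
rewrite nE; split=> [cxy|[x0 y0 t1 un]]; last first.
  apply: (in_conv_trapezoid _ _ a b (a + b - 1)) => //.
  - exact: (supp_ij_a0 _ _ _ _ a0 b0 Mab homP numP).
  - exact: (supp_ij_0b _ _ _ _ a0 b0 Mab homP numP).
  - exact: (supp_ij_n0 _ _ _ _ a0 b0 Mab homP numP).
  - exact: (supp_ij_0n _ _ _ _ a0 b0 Mab homP numP).
(* Each inequality is a half-plane containing the support, hence its hull. *)
split.
- have := in_conv_halfplane _ _ 1 0 0 _ _ cxy; rewrite /= mul1r mul0r addr0; apply.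
  by move=> v _; rewrite mul1r mul0r addr0 ler0n.
- have := in_conv_halfplane _ _ 0 1 0 _ _ cxy; rewrite /= mul1r mul0r add0r; apply.
  by move=> v _; rewrite mul1r mul0r add0r ler0n.
- have := in_conv_halfplane _ _ a%:R^-1 b%:R^-1 1 _ _ cxy.
  rewrite /= ![_^-1 * _]mulrC; apply=> -[i j] /bounds[le _] /=.
  rewrite -(ler_pM2r (mulr_gt0 aR bR)) mul1r.
  have -> : (a%:R^-1 * i%:R + b%:R^-1 * j%:R) * (a%:R * b%:R) = (b * i + a * j)%:R :> R.
    by rewrite natrD !natrM; field; rewrite !gt_eqF.
  by rewrite -natrM ler_nat.
- have := in_conv_halfplane _ _ (-1) (-1) (- (a + b - 1)%:R) _ _ cxy.
  rewrite /= !mulN1r -opprD lerN2; apply=> -[i j] /bounds[_ le] /=.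
  by rewrite !mulN1r -opprD lerN2 -natrD ler_nat.
Qed.
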